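(* Let $G$ be a graph with maximum vertex degree at most $\Delta$. Let $\mathcal T_1,\mathcal T_2$ be disjoint subsets of $V(G)$ with $|\mathcal T_1|,|\mathcal T_2|\ge\kappa$, such that $\mathcal T_1\cup\mathcal T_2$ is $\alpha$-well-linked in $G$ and each of $\mathcal T_1,\mathcal T_2$ is node-well-linked in $G$. Let $\mathcal T_1'\subset\mathcal T_1$ and $\mathcal T_2'\subset\mathcal T_2$ be any subsets with $|\mathcal T_1'|=|\mathcal T_2'|\le\frac{\alpha\kappa}{4\Delta}$. Then $\mathcal T_1'$ and $\mathcal T_2'$ are linked in $G$.
   Context: A vertex set $X$ is $\alpha$-well-linked in $G$ if for every partition $(A,B)$ of $V(G)$, $|E_G(A,B)|\ge\alpha\min\{|A\cap X|,|B\cap X|\}$. $X$ is node-well-linked in $G$ if for every pair of equal-sized subsets $X_1,X_2\subseteq X$ (not necessarily disjoint) there are $|X_1|$ vertex-disjoint paths connecting $X_1$ to $X_2$ (empty paths allowed). Two disjoint vertex sets $A,B$ are linked in $G$ if for every pair of equal-sized $A'\subseteq A$, $B'\subseteq B$ there are $|A'|$ vertex-disjoint paths connecting $A'$ to $B'$. *)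

(* Defs.v *)
From HB Require Import structures.
From mathcomp Require Import all_boot all_order all_algebra.

Set Implicit Arguments.
Unset Strict Implicit.
Unset Printing Implicit Defensive.

Import Order.TTheory GRing.Theory Num.Theory.

Record sgraph := SGraph {
  vertex :> finType;
  adj : rel vertex;
  adj_sym : symmetric adj;
  adj_irrefl : irreflexive adj
}.

Section Graph.
Variable G : sgraph.
Implicit Types A B X : {set G}.

Definition degree (x : G) : nat := #|[set y : G | adj x y]|.

Definition max_degree : nat := \max_(x : G) degree x.

(* An edge is the two-element set of its endpoints, so each edge is counted
   once. *)
Definition edges_between A B : {set {set G}} :=
  [set [set x; y] | x in A, y in B & adj x y].

Definition vertex_partition A B : Prop :=
  [disjoint A & B] /\ A :|: B = [set: G].

Definition well_linked (R : realFieldType) (alpha : R) X : Prop :=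
  forall A B, vertex_partition A B ->
    (alpha * (minn #|A :&: X| #|B :&: X|)%:R
       <= #|edges_between A B|%:R)%R.

(* A path is the nonempty duplicate-free sequence of its vertices; a
   one-vertex sequence is a path without edges. *)
Definition path_between A B (p : seq G) : bool :=
  if p is x :: q then
    [&& path (@adj G) x q, uniq (x :: q), x \in A & last x q \in B]
  else false.

Definition disjoint_paths (k : nat) A B : Prop :=
  exists P : 'I_k -> seq G,
    (forall i, path_between A B (P i)) /\
    (forall i j, i != j -> [disjoint P i & P j]).

Definition node_well_linked X : Prop :=
  forall X1 X2 : {set G}, X1 \subset X -> X2 \subset X -> #|X1| = #|X2| ->
    disjoint_paths #|X1| X1 X2.

Definition linked A B : Prop :=
  [disjoint A & B] /\
  forall A' B' : {set G}, A' \subset A -> B' \subset B -> #|A'| = #|B'| ->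
    disjoint_paths #|A'| A' B'.

End Graph.

(* Main.v *)
Require Import Defs.
From HB Require Import structures.
From mathcomp Require Import all_boot all_order all_algebra.
From mathcomp Require Import zify lra.

Set Implicit Arguments.
Unset Strict Implicit.
Unset Printing Implicit Defensive.

Import Order.TTheory GRing.Theory Num.Theory.

(** If [A'] and [B'] of size [k] are not joined by [k] disjoint paths, Menger's
    theorem gives a separator [S] with fewer than [k] vertices.  Let [C] be the
    set of vertices reachable from [A'] outside [S].  Node-well-linkedness of
    [T1] puts all but fewer than [2k] vertices of [T1] in [C], that of [T2] puts
    fewer than [k] vertices of [T2] in [C], and every edge leaving [C] ends in
    [S], so at most [Delta (k - 1)] edges leave [C]; as [k <= kappa / 4], this
    contradicts [alpha]-well-linkedness.  Menger's theorem is proved for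
    digraphs by Göring's induction on the number of edges. *)

(** * Menger's theorem *)

Section Menger.
Variable T : finType.
Implicit Types (e : rel T) (A B P Q S Z : {set T}) (k : nat).

Definition separates e A B S : Prop :=
  forall x p, path e x p -> x \in A -> last x p \in B -> has (mem S) (x :: p).

Definition linkage e k A B : Prop :=
  exists h : 'I_k -> T, exists q : 'I_k -> seq T,
    [/\ forall i, h i \in A, forall i, last (h i) (q i) \in B,
        forall i, path e (h i) (q i), forall i, uniq (h i :: q i)
      & forall i j u, u \in h i :: q i -> u \in h j :: q j -> i = j].

Definition del_edge e (x y : T) : rel T :=
  [rel u v | e u v && ((u, v) != (x, y))].

(** Stationary steps let two paths be concatenated at a shared endpoint without a separate case;
    shortening the walk removes them. *)
Definition refl_closure e : rel T := [rel u v | (u == v) || e u v].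

Lemma uniq_path_refl_closure e x p :
  path (refl_closure e) x p -> uniq (x :: p) -> path e x p.
Proof.
elim: p x => //= y p IHp x /andP[exy py].
rewrite inE negb_or -andbA => /and3P[nxy _ uyp].
by move: exy; rewrite /refl_closure /= (negPf nxy) /= => ->; apply: IHp.
Qed.

Lemma linkage_walks e k A B (h : 'I_k -> T) (q : 'I_k -> seq T) :
    (forall i, h i \in A) -> (forall i, last (h i) (q i) \in B) ->
    (forall i, path (refl_closure e) (h i) (q i)) ->
    (forall i j u, u \in h i :: q i -> u \in h j :: q j -> i = j) ->
  linkage e k A B.
Proof.
move=> hA hB hq dis.
have /fin_all_exists[q' q'P] i : exists p,
    [/\ last (h i) p \in B, path e (h i) p, uniq (h i :: p)
      & {subset h i :: p <= h i :: q i}].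
  move: (hB i).
  case/shortenP: (hq i) => p pp up sp lB.
  exists p; split=> //; first exact: uniq_path_refl_closure.
  by move=> u; rewrite !inE => /orP[->//|/sp ->]; rewrite orbT.
exists h, q'; split=> //; try by move=> i; case: (q'P i).
move=> i j u; case: (q'P i) (q'P j) => _ _ _ si [_ _ _ sj] /si ui /sj.
exact: dis.
Qed.

Lemma sub_linkage e e' k A B :
  subrel e e' -> linkage e k A B -> linkage e' k A B.
Proof.
move=> see' [h [q [hA hB hq uq dis]]]; exists h, q; split=> // i.
exact: sub_path (hq i).
Qed.

Lemma inj_ord_onto k P (g : 'I_k -> T) :
  injective g -> (forall i, g i \in P) -> #|P| = k ->
  forall s, s \in P -> exists i, s = g i.
Proof.
move=> injg gP cP s sP.
have/eqP gE : g @: [set: 'I_k] == P.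
  rewrite eqEcard card_imset // cardsT card_ord cP leqnn andbT.
  by apply/subsetP=> _ /imsetP[i _ ->].
by move: sP; rewrite -gE => /imsetP[i _ ->]; exists i.
Qed.

Lemma path_del_edge_src e x y z p :
  path e z p -> x \notin z :: p -> path (del_edge e x y) z p.
Proof.
elim: p z => //= v p IHp z /andP[ezv pv].
rewrite inE negb_or eq_sym => /andP[nxz nx].
by rewrite /del_edge /= ezv xpair_eqE (negPf nxz) IHp.
Qed.

(** Using the deleted edge means entering [y], so only the vertices after the first matter and the
    walk may still start at [y]. *)
Lemma path_del_edge_tgt e x y z p :
  path e z p -> y \notin p -> path (del_edge e x y) z p.
Proof.
elim: p z => //= v p IHp z /andP[ezv pv].
rewrite inE negb_or eq_sym => /andP[nyv ny].
by rewrite /del_edge /= ezv xpair_eqE (negPf nyv) andbF IHp.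
Qed.

Lemma separates_add_src e A B S x y :
  separates (del_edge e x y) A B S -> separates e A B (x |: S).
Proof.
move=> sepS z p pz zA zB; have [xz|nxz] := boolP (x \in z :: p).
  by apply/hasP; exists x; rewrite //= !inE eqxx.
have/hasP[s sz sS] := sepS z p (path_del_edge_src y pz nxz) zA zB.
by apply/hasP; exists s => //; apply/setU1P; right.
Qed.

Lemma separates_add_tgt e A B S x y :
  separates (del_edge e x y) A B S -> separates e A B (y |: S).
Proof.
move=> sepS z p pz zA zB; have [yz|nyz] := boolP (y \in z :: p).
  by apply/hasP; exists y; rewrite //= !inE eqxx.
have ny : y \notin p by move: nyz; rewrite inE negb_or => /andP[].
have/hasP[s sz sS] := sepS z p (path_del_edge_tgt x pz ny) zA zB.
by apply/hasP; exists s => //; apply/setU1P; right.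
Qed.

Lemma first_hit e x y P z p :
    x \in P -> path e z p -> has (mem P) (z :: p) ->
  exists p', [/\ path (del_edge e x y) z p', last z p' \in P
               & {subset z :: p' <= z :: p}].
Proof.
move=> xP; elim: p z => [|v p IHp] z /=.
  by rewrite orbF => _ zP; exists [::]; split.
case/andP=> ezv pv; have [zP _|nzP /= hP] := boolP (z \in P).
  by exists [::]; split=> // u; rewrite !inE => /eqP ->; rewrite eqxx.
have [p' [pp' lp' sp']] := IHp v pv hP.
exists (v :: p'); split=> //=.
  rewrite pp' andbT /del_edge /= ezv xpair_eqE negb_and.
  by have [zx|//] := eqVneq z x; rewrite zx xP in nzP.
by move=> u; rewrite inE => /orP[/eqP->|/sp' up]; rewrite in_cons ?eqxx ?up ?orbT.
Qed.

Lemma last_hit e x y Q z p :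
    y \in Q -> path e z p -> has (mem Q) (z :: p) ->
  exists z' p', [/\ path (del_edge e x y) z' p', z' \in Q,
                    last z' p' = last z p & {subset z' :: p' <= z :: p}].
Proof.
move=> yQ; elim: p z => [|v p IHp] z.
  by rewrite /= orbF => _ zQ; exists z, [::]; split.
move=> pz; have [hQ _|nhQ] := boolP (has (mem Q) (v :: p)).
  have pv : path e v p by case/andP: pz.
  have [z' [p' [pp' z'Q lp' sp']]] := IHp v pv hQ.
  by exists z', p'; split=> // u /sp' up; rewrite in_cons up orbT.
rewrite -cat1s has_cat (negPf nhQ) orbF /= orbF => zQ.
exists z, (v :: p); split=> //; apply: path_del_edge_tgt => //.
by apply: contra nhQ => yp; apply/hasP; exists y.
Qed.

(** The part of a walk up to its first vertex in [P] survives the edge deletion, hence already meets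
    [Z]. *)
Lemma separates_first_hit e A B P Z x y :
    x \in P -> separates e A B P -> separates (del_edge e x y) A P Z ->
  separates e A B Z.
Proof.
move=> xP sepP sepZ z p pz zA zB.
have [p' [pp' lp' sp']] := first_hit y xP pz (sepP z p pz zA zB).
have/hasP[s sz sZ] := sepZ z p' pp' zA lp'.
by apply/hasP; exists s => //; apply: sp'.
Qed.

Lemma separates_last_hit e A B Q Z x y :
    y \in Q -> separates e A B Q -> separates (del_edge e x y) Q B Z ->
  separates e A B Z.
Proof.
move=> yQ sepQ sepZ z p pz zA zB.
have [z' [p' [pp' z'Q lp' sp']]] := last_hit x yQ pz (sepQ z p pz zA zB).
rewrite -lp' in zB; have/hasP[s sz sZ] := sepZ z' p' pp' z'Q zB.
by apply/hasP; exists s => //; apply: sp'.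
Qed.

(** By counting, the ends of the first linkage exhaust [x |: S] and the starts of the second exhaust
    [y |: S]. Paths are joined at their common vertex of [S], and the remaining pair through the
    edge from [x] to [y]. *)
Lemma linkage_glue e k A B S x y :
    e x y -> separates (del_edge e x y) A B S ->
    x \notin S -> y \notin S -> #|x |: S| = k -> #|y |: S| = k ->
    linkage (del_edge e x y) k A (x |: S) ->
    linkage (del_edge e x y) k (y |: S) B ->
  linkage e k A B.
Proof.
move=> exy sepS xS yS cP cQ [h1 [q1 [h1A l1P p1 u1 d1]]].
move=> [h2 [q2 [h2Q l2B p2 u2 d2]]].
pose l1 i := last (h1 i) (q1 i).
have l1_in i : l1 i \in h1 i :: q1 i by apply: mem_last.
have l1_inj : injective l1.
  by move=> i j eij; apply: (d1 i j (l1 i)); rewrite // eij.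
have h2_in j : h2 j \in h2 j :: q2 j by apply: mem_head.
have h2_inj : injective h2.
  by move=> i j eij; apply: (d2 i j (h2 i)); rewrite // eij.
have onP := inj_ord_onto l1_inj l1P cP.
have onQ := inj_ord_onto h2_inj h2Q cQ.
(* A common vertex yields an A-B walk avoiding the deleted edge, which meets
   [S]; each path meets its end set only in its own endpoint. *)
have cross i j u : u \in h1 i :: q1 i -> u \in h2 j :: q2 j ->
    [/\ u \in S, u = l1 i & u = h2 j].
  move=> ui uj.
  have endP s : s \in S -> s \in h1 i :: q1 i -> s = l1 i.
    move=> sS si; have [|i' si'] := onP s; first by rewrite inE sS orbT.
    by rewrite si' (d1 i i' s) // si'.
  have headQ s : s \in S -> s \in h2 j :: q2 j -> s = h2 j.
    move=> sS sj; have [|j' sj'] := onQ s; first by rewrite inE sS orbT.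
    by rewrite sj' (d2 j j' s) // sj'.
  suff uS : u \in S by split; [|exact: endP|exact: headQ].
  move: (p1 i) (u1 i) (p2 j) (u2 j) (l2B j) endP headQ; rewrite /l1.
  case/splitPl: ui => a1 a2 la; case/splitPl: uj => b1 b2 lb.
  rewrite !cat_path la lb => /andP[pa1 _] ua /andP[_ pb2] ub.
  rewrite last_cat lb => lB endP headQ.
  have/hasP[s] : has (mem S) (h1 i :: a1 ++ b2).
    by apply: sepS; rewrite ?cat_path ?pa1 ?la ?last_cat ?la.
  (* A vertex of [S] after [u] on the second path would repeat its head. One on the first path up to
     [u] is the endpoint of that path, so [a2] is empty and it is [u]. *)
  rewrite -cat_cons mem_cat => /orP[sa sS|sb sS]; last first.
    have sE : s = h2 j by apply: headQ; rewrite // inE mem_cat sb !orbT.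
    by move: ub; rewrite /= mem_cat -sE sb orbT.
  have sE : s = last u a2.
    by rewrite (endP s sS) ?last_cat ?la // -cat_cons mem_cat sa.
  case: a2 ua {endP} sE => [_ /= <- //|v a2].
  rewrite -cat_cons cat_uniq.
  case/and3P=> _ /hasPn dis _ /= sE; have := dis (last v a2) (mem_last _ _).
  by rewrite -sE /= sa.
(* The bijection from [x |: S] to [y |: S] fixing [S] decides which paths are joined; [g] below is
   the resulting reindexing. *)
pose tau s := if s == x then y else s.
have tauQ s : s \in x |: S -> tau s \in y |: S.
  rewrite /tau !inE; case: (eqVneq s x) => [_ _|_ /= ->]; last exact: orbT.
  by rewrite eqxx.
have tau_inj s t : s \in x |: S -> t \in x |: S -> tau s = tau t -> s = t.
  rewrite /tau !inE; case: (eqVneq s x) => [->|_]; case: (eqVneq t x) => [->|_] //=.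
  - by move=> _ tS yt; rewrite yt tS in yS.
  - by move=> sS _ yt; rewrite -yt sS in yS.
have /fin_all_exists[g gP] i : exists j, tau (l1 i) = h2 j.
  by apply: onQ; apply: tauQ; apply: l1P.
(* A shared vertex lies in [S], where [tau] is the identity, so the two paths are exactly those
   glued at it. *)
have cross_eq i j u : u \in h1 i :: q1 i -> u \in h2 (g j) :: q2 (g j) -> i = j.
  move=> ui uj; have [uS ul uh] := cross _ _ _ ui uj.
  have nux : u != x by apply: contraNneq xS => <-.
  apply: l1_inj; apply: tau_inj; rewrite ?l1P // [RHS]gP -uh -ul.
  by rewrite /tau (negPf nux).
apply: (@linkage_walks e k A B h1 (fun i => q1 i ++ h2 (g i) :: q2 (g i))) => //.
- by move=> i; rewrite last_cat /=.
- move=> i; rewrite cat_path /=; apply/and3P; split.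
  + by apply: sub_path (p1 i) => u v /andP[euv _]; rewrite /refl_closure /= euv orbT.
  + rewrite -gP -/(l1 i) /tau /refl_closure /=; case: (eqVneq (l1 i) x) => [->|_].
      by rewrite exy orbT.
    by rewrite eqxx.
  + by apply: sub_path (p2 _) => u v /andP[euv _]; rewrite /refl_closure /= euv orbT.
- move=> i j u; rewrite -!cat_cons !mem_cat => /orP[ui|ui] /orP[uj|uj].
  + exact: d1 ui uj.
  + exact: cross_eq ui uj.
  + by apply/esym; apply: cross_eq uj ui.
  + have gij := d2 _ _ _ ui uj.
    by apply: l1_inj; apply: tau_inj; rewrite ?l1P // !gP gij.
Qed.

Theorem menger e k A B :
  (exists2 S, separates e A B S & #|S| < k) \/ linkage e k A B.
Proof.
have [n] := ubnP #|[set u : T * T | e u.1 u.2]|.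
elim: n => // n IHn in e A B *; rewrite ltnS => le_n.
have [[x y] exy|noe] := pickP (fun u : T * T => e u.1 u.2); last first.
  (* Without edges every walk is a single vertex: [A :&: B] separates, and its elements are
     themselves disjoint paths. *)
  have [lt|ge] := ltnP #|A :&: B| k.
    left; exists (A :&: B) => // x [|y p] /=.
      by rewrite inE => _ -> ->.
    by have /= -> := noe (x, y).
  right; exists (fun i => enum_val (widen_ord ge i)), (fun=> [::]).
  have AB i : enum_val (widen_ord ge i) \in A :&: B by apply: enum_valP.
  split=> //= [i|i|i j u].
  - by have := AB i; rewrite inE => /andP[].
  - by have := AB i; rewrite inE => /andP[].
  - rewrite !inE => /eqP -> /eqP /enum_val_inj /(congr1 val) /= ij.
    exact: val_inj.
have lt_n : #|[set u : T * T | del_edge e x y u.1 u.2]| < n.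
  apply: leq_trans le_n; apply: proper_card; apply/properP; split.
    by apply/subsetP=> u; rewrite !inE => /andP[].
  by exists (x, y); rewrite !inE // /del_edge /= eqxx andbF.
have sub_e : subrel (del_edge e x y) e by move=> u v /andP[].
have [[S sepS ltS]|] := IHn _ A B lt_n; last by move=> /(sub_linkage sub_e); right.
have sepP := separates_add_src sepS; have sepQ := separates_add_tgt sepS.
have [ltP|geP] := ltnP #|x |: S| k; first by left; exists (x |: S).
have [ltQ|geQ] := ltnP #|y |: S| k; first by left; exists (y |: S).
have [Z|lnk1] := IHn _ A (x |: S) lt_n.
  by case: Z => Z /(separates_first_hit (setU11 x S) sepP); left; exists Z.
have [Z|lnk2] := IHn _ (y |: S) B lt_n.
  by case: Z => Z /(separates_last_hit (setU11 y S) sepQ); left; exists Z.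
right; apply: linkage_glue exy sepS _ _ _ _ lnk1 lnk2.
(* As [S] has fewer than [k] vertices, both enlargements reach [k] only if [x] and [y] are new and
   [S] has exactly [k - 1]. *)
all: move: geP geQ; rewrite !cardsU1; case: (x \in S); case: (y \in S) => //=; lia.
Qed.

End Menger.

(** * Small separators in well-linked sets *)

Section Cuts.
Variable G : sgraph.
Implicit Types A B C S X : {set G}.

Lemma linkage_disjoint_paths k A B :
  linkage (@adj G) k A B -> disjoint_paths k A B.
Proof.
case=> h [q [hA hB hq uq dis]]; exists (fun i => h i :: q i); split.
  by move=> i; rewrite /path_between hq uq hA hB.
move=> i j nij; rewrite disjoint_has; apply/hasPn=> u ui /=.
by apply: contra nij => uj; apply/eqP; apply: dis ui uj.
Qed.

(** Pigeonhole: if [S] met every path, choosing a common vertex on each would inject [k] indices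
    into [S]. *)
Lemma disjoint_paths_avoid k A B S :
    disjoint_paths k A B -> #|S| < k ->
  exists x p, [/\ path (@adj G) x p, x \in A, last x p \in B
                & ~~ has (mem S) (x :: p)].
Proof.
case=> P [pP dis] ltS.
have [/existsP[i]|hit] := boolP [exists i, ~~ has (mem S) (P i)].
  by have := pP i; case: (P i) => //= x p /and4P[]; exists x, p.
have /fin_all_exists[f fP] i : exists s, s \in P i /\ s \in S.
  move: hit; rewrite negb_exists => /forallP/(_ i); rewrite negbK.
  by case/hasP=> s; exists s.
have f_inj : injective f.
  move=> i j fij; apply/eqP; apply: contraT => /dis.
  rewrite disjoint_has => /hasPn/(_ (f i)) /=.
  by rewrite {2}fij; case: (fP i) (fP j) => -> _ [-> _] => /(_ isT).
have : #|f @: [set: 'I_k]| <= #|S|.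
  by apply: subset_leq_card; apply/subsetP=> _ /imsetP[i _ ->]; case: (fP i).
by rewrite card_imset // cardsT card_ord leqNgt ltS.
Qed.

(** Charge each edge to an endpoint in [S]; a vertex [s] receives at most [degree s] edges. *)
Lemma card_edges_between A B S :
    (forall u v, u \in A -> v \in B -> adj u v -> (u \in S) || (v \in S)) ->
  #|edges_between A B| <= #|S| * max_degree G.
Proof.
move=> cov.
have sub : edges_between A B \subset
    \bigcup_(s in S) [set [set s; v] | v in [set v | adj s v]].
  apply/subsetP=> _ /imset2P[u v uA + ->]; rewrite inE => /andP[vB uv].
  have /orP[uS|vS] := cov _ _ uA vB uv; apply/bigcupP.
    by exists u => //; apply/imsetP; exists v; rewrite ?inE.
  by exists v => //; apply/imsetP; exists u; rewrite ?inE ?(adj_sym v) // setUC.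
apply: leq_trans (subset_leq_card sub) _; rewrite -sum_nat_const.
apply: leq_trans (_ : \sum_(s in S) degree s <= _); last first.
  by apply: leq_sum => s _; apply: leq_bigmax.
elim/big_rec2: _ => [|s n U _ IH]; first by rewrite cards0.
apply: leq_trans (leq_card_setU _ _) _; apply: leq_add IH.
exact: leq_imset_card.
Qed.

(** * Reachability outside a separator *)

Definition reach A S : {set G} :=
  [set v | [exists a in A :\: S, connect [rel u w | adj u w && (w \notin S)] a v]].

Lemma reach_source A S a : a \in A -> a \notin S -> a \in reach A S.
Proof.
move=> aA aS; rewrite inE; apply/existsP; exists a.
by rewrite inE aA aS connect0.
Qed.

Lemma reach_step A S u v :
  u \in reach A S -> adj u v -> v \notin S -> v \in reach A S.
Proof.
rewrite !inE => /existsP[a /andP[aA cau]] uv vS; apply/existsP; exists a.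
by rewrite aA (connect_trans cau) //; apply: connect1; rewrite /= uv vS.
Qed.

Lemma reach_walk A S x p :
  path (@adj G) x p -> ~~ has (mem S) (x :: p) ->
  (x \in reach A S) = (last x p \in reach A S).
Proof.
elim: p x => //= y p IHp x /andP[xy py]; rewrite !negb_or => /and3P[xS yS pS].
rewrite -IHp //= ?negb_or ?yS //; apply/idP/idP => r.
  exact: reach_step r xy yS.
by apply: reach_step r _ xS; rewrite adj_sym.
Qed.

Lemma reach_separated A B S v :
  separates (@adj G) A B S -> v \in B -> v \notin reach A S.
Proof.
move=> sepS vB; rewrite inE; apply/existsPn=> a; rewrite inE.
apply/negP=> /andP[/andP[aS aA]] /connectP[p pp vE].
have : has (mem S) (a :: p).
  by apply: sepS; rewrite -?vE //; apply: sub_path pp => u w /andP[].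
rewrite /= (negPf aS) /= {vE}; elim: p a {aS aA} pp => //= y p IHp a.
by case/andP=> /andP[_ /negPf ->] /= /IHp.
Qed.

(** Otherwise [k] disjoint paths lead from [A] to [k] vertices of [X] missed by [reach A S] and [S].
    One of them avoids [S], so its end is reachable after all. *)
Lemma reach_most A S X k :
    node_well_linked X -> A \subset X -> #|A| = k -> #|S| < k ->
  #|X :\: (reach A S :|: S)| < k.
Proof.
move=> nwX AX cA ltS; rewrite ltnNge; apply/negP=> /card_geqP[s [us ss sX]].
pose X2 := [set z in s].
have cX2 : #|A| = #|X2| by rewrite cA cardsE -ss; apply/esym/card_uniqP.
have X2sub z : z \in X2 -> z \in X :\: (reach A S :|: S) by rewrite inE => /sX.
have X2X : X2 \subset X by apply/subsetP=> z /X2sub; rewrite inE => /andP[].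
have [|x [p [pp xA lX2 nS]]] := disjoint_paths_avoid (S := S) (nwX _ _ AX X2X cX2).
  by rewrite cA.
have xS : x \notin S by move: nS; rewrite /= negb_or => /andP[].
have := X2sub _ lX2; rewrite !in_setD in_setU.
by rewrite -(reach_walk A pp nS) reach_source.
Qed.

(** Otherwise [k] disjoint paths join [B] to [k] reachable vertices of [X]. One avoids [S], which
    makes its end in [B] reachable and contradicts separation. *)
Lemma reach_few A B S X k :
    node_well_linked X -> B \subset X -> #|B| = k -> #|S| < k ->
    separates (@adj G) A B S ->
  #|X :&: reach A S| < k.
Proof.
move=> nwX BX cB ltS sepS; rewrite ltnNge; apply/negP=> /card_geqP[s [us ss sX]].
pose X2 := [set z in s].
have cX2 : #|B| = #|X2| by rewrite cB cardsE -ss; apply/esym/card_uniqP.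
have X2sub z : z \in X2 -> z \in X :&: reach A S by rewrite inE => /sX.
have X2X : X2 \subset X by apply/subsetP=> z /X2sub; rewrite inE => /andP[].
have [|x [p [pp xB lX2 nS]]] := disjoint_paths_avoid (S := S) (nwX _ _ BX X2X cX2).
  by rewrite cB.
have := X2sub _ lX2; rewrite in_setI -(reach_walk A pp nS).
by rewrite (negPf (reach_separated sepS xB)) andbF.
Qed.

Lemma vertex_partitionC A : vertex_partition A (~: A).
Proof. by split; [rewrite -subsets_disjoint|rewrite setUCr]. Qed.

(** Test well-linkedness on the cut around a single vertex of [X]: the minimum is 1 and at most
    [max_degree G] edges cross. *)
Lemma well_linked_le_degree (R : realFieldType) (alpha : R) X :
  1 < #|X| -> well_linked alpha X -> (alpha <= (max_degree G)%:R)%R.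
Proof.
move=> X_gt1 wl; have /card_gt0P[x xX] := ltnW X_gt1.
have := wl _ _ (vertex_partitionC [set x]).
have -> : [set x] :&: X = [set x] by apply/setIidPl; rewrite sub1set.
have -> : ~: [set x] :&: X = X :\ x by rewrite setIC setDE.
have := cardsD1 x X; rewrite xX cards1 => cX.
have -> : minn 1 #|X :\ x| = 1 by lia.
rewrite mulr1 => /le_trans; apply; rewrite ler_nat.
rewrite -[max_degree G]mul1n -(cards1 x); apply: card_edges_between.
by move=> u v ->.
Qed.

End Cuts.

(** * Linkedness of small subsets *)

Theorem theorem2p5 (R : realFieldType) (G : sgraph) (Delta kappa : nat)
    (alpha : R) (T1 T2 T1' T2' : {set G}) :
  max_degree G <= Delta ->
  [disjoint T1 & T2] ->
  kappa <= #|T1| ->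
  kappa <= #|T2| ->
  well_linked alpha (T1 :|: T2) ->
  node_well_linked T1 ->
  node_well_linked T2 ->
  T1' \subset T1 ->
  T2' \subset T2 ->
  #|T1'| = #|T2'| ->
  (#|T1'|%:R <= alpha * kappa%:R / (4%:R * Delta%:R))%R ->
  linked T1' T2'.
Proof.
move=> degD dT kT1 kT2 wl nw1 nw2 sT1 sT2 _ small.
split; first exact: disjointW sT1 sT2 dT.
move=> A' B' sA sB cAB; have cA := subset_leq_card sA.
have [[S sepS ltS]|] := menger (@adj G) #|A'| A' B'; last exact: linkage_disjoint_paths.
exfalso; set k := #|A'| in ltS cA cAB.
have {}small : (k%:R <= alpha * kappa%:R / (4%:R * Delta%:R))%R.
  by apply: le_trans small; rewrite ler_nat.
have k_gt0 : (0 < k%:R :> R)%R by rewrite ltr0n; lia.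
(* Division by zero yields 0, so [Delta = 0] would force [k <= 0]. *)
have D_gt0 : (0 < Delta%:R :> R)%R.
  rewrite ltr0n lt0n; apply/eqP=> D0.
  by move: small; rewrite D0 mulr0 invr0 mulr0 leNgt k_gt0.
have {}small : (4%:R * (Delta%:R * k%:R) <= alpha * kappa%:R)%R.
  by move: small; rewrite ler_pdivlMr ?mulr_gt0 // [(k%:R * _)%R]mulrC mulrA.
have Dk_gt0 : (0 < Delta%:R * k%:R :> R)%R by rewrite mulr_gt0.
have ak_gt0 : (0 < alpha * kappa%:R)%R by lra.
have kap_gt0 : (0 < kappa%:R :> R)%R.
  by rewrite lt0r ler0n andbT; apply: contraTneq ak_gt0 => ->; rewrite mulr0 ltxx.
have a_gt0 : (0 < alpha)%R by rewrite -(pmulr_lgt0 _ kap_gt0).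
have cT : #|T1 :|: T2| = #|T1| + #|T2|.
  by move: (leq_card_setU T1 T2).2; rewrite dT => /eqP.
have a_le : (alpha <= Delta%:R)%R.
  apply: le_trans (well_linked_le_degree _ wl) _; last by rewrite ler_nat.
  by rewrite cT; move: kap_gt0; rewrite ltr0n; lia.
(* Cancel [Delta] in [4 Delta k <= alpha kappa <= Delta kappa]. *)
have k_le : (4%:R * k%:R <= kappa%:R :> R)%R.
  rewrite -(ler_pM2l D_gt0); apply: le_trans (_ : (alpha * kappa%:R <= _)%R).
    by rewrite mulrCA.
  by rewrite ler_pM2r.
have {}k_le : 4 * k <= kappa by move: k_le; rewrite -natrM ler_nat.
set C := reach A' S.
have few1 : #|T1 :\: (C :|: S)| < k.
  exact: reach_most nw1 (subset_trans sA sT1) (erefl k) ltS.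
have few2 : #|T2 :&: C| < k.
  exact: reach_few nw2 (subset_trans sB sT2) (esym cAB) ltS sepS.
(* Of [T1], fewer than [k] vertices are lost to [S] and fewer than [k] to the rest outside [C]. *)
have inC : kappa - k.*2 <= #|C :&: (T1 :|: T2)|.
  have : #|T1| <= #|C :&: (T1 :|: T2)| + #|S| + #|T1 :\: (C :|: S)|.
    apply: leq_trans (leq_add (leq_card_setU _ _) (leqnn _)).
    apply: leq_trans (leq_card_setU _ _); apply: subset_leq_card.
    apply/subsetP=> z zT; rewrite !(in_setU, in_setI, in_setD) zT.
    by case: (z \in C); case: (z \in S).
  lia.
have outC : kappa - k.*2 <= #|~: C :&: (T1 :|: T2)|.
  have : #|T2 :\: C| <= #|~: C :&: (T1 :|: T2)|.
    apply: subset_leq_card; apply/subsetP=> z; rewrite !inE => /andP[-> ->].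
    by rewrite orbT.
  have := cardsID C T2; lia.
have edges : #|edges_between C (~: C)| <= #|S| * max_degree G.
  apply: card_edges_between => u v uC; rewrite inE => vC uv.
  by apply/orP; right; apply: contraR vC => vS; apply: reach_step uC uv vS.
have := wl _ _ (vertex_partitionC C); apply/negP; rewrite -ltNge.
apply: le_lt_trans (_ : (k%:R * Delta%:R < _)%R).
  rewrite -natrM ler_nat; apply: leq_trans edges _.
  by rewrite leq_mul // ltnW.
apply: lt_le_trans (_ : (alpha * (kappa - k.*2)%:R <= _)%R); last first.
  by rewrite ler_pM2l // ler_nat leq_min inC outC.
(* From [4 k <= kappa], removing [2 k] leaves at least half of [kappa]. Hence the cut needs at least
   [alpha kappa / 2 >= 2 Delta k] edges, strictly more than [Delta k]. *)
have half : (alpha * kappa%:R <= 2%:R * (alpha * (kappa - k.*2)%:R))%R.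
  rewrite mulrCA ler_pM2l // -natrM ler_nat; lia.
rewrite [(k%:R * _)%R]mulrC; lra.
Qed.
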